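(* Let $\mathcal{T}_n$ be the set of tournaments on vertex set $[n]=\{1,\dots,n\}$. There is a constant $c>0$ such that for all sufficiently large $n$, if $D$ is chosen uniformly at random from $\mathcal{T}_n$, then $\Pr(D\text{ is oblivious})\le e^{-cn}$.
   Context: A tournament $D$ is a digraph (finite vertex set $V(D)$, arcs are ordered pairs of distinct vertices) such that for all distinct $u,v$ exactly one of $uv,vu$ is an arc; $N^+(v)=\{u:vu\in E(D)\}$, $N^-(v)=\{u:uv\in E(D)\}$. A restriction vector is a vector $\mathbf{r}$ of nonnegative integers indexed by $V(D)$; $\operatorname{supp}(\mathbf{r})=\{v:\mathbf{r}_v>0\}$; $\delta_v$ is the indicator vector of $v$. Semi-restricted $D$-game with parameter $\mathbf{r}$: Rei and Norman play $\sum_u\mathbf{r}_u$ rounds; in each round both simultaneously choose a vertex, Rei being required to choose each $u$ exactly $\mathbf{r}_u$ times overall, Norman unrestricted. A strategy for Norman is a function $\mathcal{N}$ assigning to each restriction vector a random variable with values in $V(D)$; a strategy for Rei is a function $\mathcal{R}$ assigning to each $\mathbf{r}$ a random variable with values in $\operatorname{supp}(\mathbf{r})$ (choices independent across players and rounds). Norman's score is defined recursively: $0$ if $\mathbf{r}=0$; otherwise with $x=\mathcal{N}(\mathbf{r})$, $y=\mathcal{R}(\mathbf{r})$, Norman gains $+1$ if $y\in N^+(x)$, $-1$ if $y\in N^-(x)$, $0$ otherwise, and play continues from $\mathbf{r}-\delta_y$. $S_D(\mathbf{r};\mathcal{N},\mathcal{R})$ is the expected score, $S_D(\mathbf{r};\mathcal{R})=\max_{\mathcal{N}}S_D(\mathbf{r};\mathcal{N},\mathcal{R})$,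 $S_D(\mathbf{r})=\min_{\mathcal{R}}S_D(\mathbf{r};\mathcal{R})$; $\mathcal{R}$ is optimal if $S_D(\mathbf{r};\mathcal{R})=S_D(\mathbf{r})$ for all $\mathbf{r}$. A strategy $\mathcal{R}$ for Rei is oblivious if the distribution of $\mathcal{R}(\mathbf{r})$ depends only on $\operatorname{supp}(\mathbf{r})$; $D$ is oblivious if Rei has an optimal strategy that is oblivious. *)

(* Defs.v *)
From HB Require Import structures.
From mathcomp Require Import all_boot all_order all_algebra.
From mathcomp Require Import boolp classical_sets reals.

Set Implicit Arguments.
Unset Strict Implicit.
Unset Printing Implicit Defensive.

Import Order.TTheory GRing.Theory Num.Theory.
Local Open Scope ring_scope.

(* A digraph on the finite type V is given by its set of arcs; (u, v) is the
   arc from u to v. *)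
Definition digraph (V : finType) := {set V * V}.

Definition is_tournament (V : finType) (D : digraph V) : bool :=
  [forall u, (u, u) \notin D] &&
  [forall u, forall v, (u != v) ==> (((u, v) \in D) (+) ((v, u) \in D))].

Definition out_nbr (V : finType) (D : digraph V) (v : V) : {set V} :=
  [set u | (v, u) \in D]%SET.

Definition in_nbr (V : finType) (D : digraph V) (v : V) : {set V} :=
  [set u | (u, v) \in D]%SET.

Definition restriction (V : finType) := {ffun V -> nat}.

Definition supp (V : finType) (r : restriction V) : {set V} :=
  [set v | (0 < r v)%N]%SET.

Definition num_rounds (V : finType) (r : restriction V) : nat :=
  (\sum_(u : V) r u)%N.

(* r - delta_y; the truncation of natural-number subtraction is only reached
   when y is outside the support of r, which Rei may not choose. *)
Definition play (V : finType) (r : restriction V) (y : V) : restriction V :=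
  [ffun u => (r u - (u == y))%N].

(* The V-valued random variables used by the players enter only through their
   laws, since all choices are independent. *)
Definition is_distribution (R : realType) (V : finType) (p : {ffun V -> R}) :
    Prop :=
  (forall v, 0 <= p v) /\ \sum_(v : V) p v = 1.

Definition strategy (R : realType) (V : finType) :=
  restriction V -> {ffun V -> R}.

Definition norman_strategy (R : realType) (V : finType) (N : strategy R V) :
    Prop :=
  forall r, is_distribution (N r).

(* No condition is put on the null vector: its support is empty, and no choice
   is made there. *)
Definition rei_strategy (R : realType) (V : finType) (S : strategy R V) :
    Prop :=
  forall r, supp r != finset.set0 ->
    is_distribution (S r) /\ (forall v, v \notin supp r -> S r v = 0).

(* Norman's gain in a round in which Norman chooses x and Rei chooses y. *)
Definition gain (R : realType) (V : finType) (D : digraph V) (x y : V) : R :=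
  if y \in out_nbr D x then 1
  else if y \in in_nbr D x then -1
  else 0.

(* A history lists the pairs (Norman's choice, Rei's choice) in the order of
   the rounds. *)
Fixpoint score (R : realType) (V : finType) (D : digraph V)
    (h : seq (V * V)) : R :=
  if h is (x, y) :: h' then gain R D x y + score R D h' else 0.

(* The probability that the game started at r begins with the history h. *)
Fixpoint history_prob (R : realType) (V : finType) (N S : strategy R V)
    (r : restriction V) (h : seq (V * V)) : R :=
  if h is (x, y) :: h' then
    N r x * S r y * history_prob N S (play r y) h'
  else 1.

Definition expected_score (R : realType) (V : finType) (D : digraph V)
    (r : restriction V) (N S : strategy R V) : R :=
  \sum_(h : (num_rounds r).-tuple (V * V)) history_prob N S r h * score R D h.

(* S_D(r; S), the maximum over Norman's strategies.  The score depends
   continuously on the finitely many distributions N(r') with r' <= r, which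
   range over compact simplices, so the supremum is a maximum; the same holds
   for the minimum over Rei's strategies below. *)
Definition best_response_score (R : realType) (V : finType) (D : digraph V)
    (r : restriction V) (S : strategy R V) : R :=
  sup [set expected_score D r N S | N in [set N | norman_strategy N]]%classic.

Definition game_value (R : realType) (V : finType) (D : digraph V)
    (r : restriction V) : R :=
  inf [set best_response_score D r S | S in
         [set S : strategy R V | rei_strategy S]]%classic.

Definition optimal (R : realType) (V : finType) (D : digraph V)
    (S : strategy R V) : Prop :=
  forall r, best_response_score D r S = game_value R D r.

Definition oblivious_strategy (R : realType) (V : finType)
    (S : strategy R V) : Prop :=
  forall r r', supp r = supp r' -> S r = S r'.

Definition oblivious (R : realType) (V : finType) (D : digraph V) : Prop :=
  exists S : strategy R V,
    [/\ rei_strategy S, optimal D S & oblivious_strategy S].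

Definition tournaments (n : nat) : {set digraph 'I_n} :=
  [set D : digraph 'I_n | is_tournament D]%SET.

(* The probability of the event P for D uniform in tournaments n. *)
Definition tournament_prob (R : realType) (n : nat)
    (P : digraph 'I_n -> Prop) : R :=
  #|[set D in tournaments n | `[< P D >]]%SET|%:R / #|tournaments n|%:R.

(* Main.v *)
Require Import Defs.
From HB Require Import structures.
From mathcomp Require Import all_boot all_order all_algebra.
From mathcomp Require Import boolp classical_sets reals sequences exp.
From mathcomp Require Import ring lra.

(** Suppose that no out-neighbourhood of the tournament D is contained in
    another one, and that Rei has an optimal strategy playing the distribution p
    whenever every vertex is still available.  Given a vertex x, choose a
    positive integer vector rho against which x is Norman's unique best fixed
    choice, and start from m rho.  If Rei draws uniformly at random from the
    remaining cards, the proportions of the cards form a martingale with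
    variance O(1/k) when k cards remain, so that Norman gains at most
    m (A rho)_x + O(log m), where A is the payoff matrix.  Against the optimal
    strategy, Norman can play a best response z to p while all the cards are
    available, at least m rounds, and x afterwards; he then gains at least
    m (A rho)_x + m ((A p)_z - (A p)_x).  Hence every x is a best response to p,
    and A p = 0 because A is skew-symmetric.

    Modulo 2 the matrix A is J - I, so its kernel has dimension at most one and
    is spanned by a vector without zero entry.  Reversing the arcs across a cut
    changes the signs of this vector on one side of the cut; hence among the
    2^(n-1) tournaments of a switching class at most one has a nonnegative
    kernel vector.  Finally, an inclusion between two out-neighbourhoods exists
    with probability at most n^2 (3/4)^(n-2). *)

Set Implicit Arguments.
Unset Strict Implicit.
Unset Printing Implicit Defensive.

Import Order.TTheory GRing.Theory Num.Theory.
Local Open Scope ring_scope.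

(** * Recursion for the expected score *)

Lemma big_tuple_pair_cons (R : nmodType) (T U : finType) (k : nat)
    (F : seq (T * U) -> R) :
  \sum_(h : k.+1.-tuple (T * U)) F h =
    \sum_x \sum_y \sum_(h : k.-tuple (T * U)) F ((x, y) :: h).
Proof.
rewrite (pair_bigA _ (fun x y => \sum_(h : k.-tuple _) F ((x, y) :: h))) pair_bigA.
rewrite (reindex (fun p : T * U * k.-tuple _ => [tuple of p.1 :: p.2])) /=.
  by apply: eq_bigr => [[[x y] h]] _.
exists (fun h : k.+1.-tuple _ => (thead h, [tuple of behead h])) => [[x h] _|h _].
  by rewrite theadE /=; congr (_, _); apply/val_inj.
by rewrite /= -tuple_eta.
Qed.

Section Game.
Variables (R : realType) (V : finType) (D : digraph V).
Implicit Types (r : restriction V) (N S : strategy R V).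

Lemma num_rounds_play r y : y \in supp r ->
  num_rounds r = (num_rounds (play r y)).+1.
Proof.
rewrite inE => ry; rewrite /num_rounds (bigD1 y) //= [in RHS](bigD1 y) //=.
rewrite ffunE eqxx subn1 -addSn prednK //; congr (_ + _)%N.
by apply: eq_bigr => u /negPf uy; rewrite ffunE uy subn0.
Qed.

Lemma supp_eq0 r : (supp r == finset.set0) = (num_rounds r == 0%N).
Proof.
rewrite /num_rounds sum_nat_eq0; apply/eqP/forallP => [r0 u|r0].
  by apply/implyP => _; have /setP/(_ u) := r0; rewrite !inE lt0n => /negPn.
by apply/setP => u; rewrite !inE lt0n (implyP (r0 u)).
Qed.

Lemma rei_sum S r (f g : V -> R) : rei_strategy S -> supp r != finset.set0 ->
  (forall y, y \in supp r -> f y = g y) ->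
  \sum_y S r y * f y = \sum_y S r y * g y.
Proof.
move=> rS r0 fg; apply: eq_bigr => y _.
have [yr|yr] := boolP (y \in supp r); first by rewrite fg.
by rewrite (rS r r0).2 // !mul0r.
Qed.

Lemma rei_sum_le S r (f g : V -> R) : rei_strategy S ->
  supp r != finset.set0 -> (forall y, y \in supp r -> f y <= g y) ->
  \sum_y S r y * f y <= \sum_y S r y * g y.
Proof.
move=> rS r0 fg; apply: ler_sum => y _.
have [yr|yr] := boolP (y \in supp r).
  by rewrite ler_wpM2l ?fg ?(rS r r0).1.1.
by rewrite (rS r r0).2 // !mul0r.
Qed.

Lemma sum_distribution (p : {ffun V -> R}) c :
  is_distribution p -> \sum_y p y * c = c.
Proof. by case=> _ p1; rewrite -mulr_suml p1 mul1r. Qed.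

Lemma history_prob_sum N S k r : norman_strategy N -> rei_strategy S ->
  num_rounds r = k -> \sum_(h : k.-tuple (V * V)) history_prob N S r h = 1.
Proof.
move=> nN rS; elim: k r => [|k IH] r rk.
  rewrite (eq_bigr (fun=> 1)) => [|h _]; last by rewrite tuple0.
  by rewrite sumr_const card_tuple.
have r0 : supp r != finset.set0 by rewrite supp_eq0 rk.
rewrite (big_tuple_pair_cons _ (history_prob N S r)) /=.
rewrite -[RHS](nN r).2; apply: eq_bigr => x _.
under eq_bigr do rewrite -mulr_sumr -mulrA.
rewrite -mulr_sumr (rei_sum rS r0 (g := fun=> 1)).
  by rewrite -mulr_suml (rS r r0).1.2 !mulr1.
by move=> y yr; apply: IH; apply: succn_inj; rewrite -rk (num_rounds_play yr).
Qed.

(** The gain of the first round is constant over its continuations, whose total probability is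
    [1]. *)
Lemma expected_scoreS N S r : norman_strategy N -> rei_strategy S ->
  supp r != finset.set0 ->
  expected_score D r N S = \sum_x N r x *
    \sum_y S r y * (gain R D x y + expected_score D (play r y) N S).
Proof.
move=> nN rS r0; rewrite /expected_score.
case rk: (num_rounds r) => [|k]; first by rewrite supp_eq0 rk eqxx in r0.
rewrite (big_tuple_pair_cons _ (fun h => history_prob N S r h * score R D h)) /=.
apply: eq_bigr => x _; rewrite mulr_sumr; apply: eq_bigr => y _.
(* Outside the support [play] leaves [r] unchanged, but Rei's weight there is [0]. *)
have [yr|yr] := boolP (y \in supp r); last first.
  by rewrite (rS r r0).2 // mul0r mulr0 big1 // => h _; rewrite !mul0r.
have yk : num_rounds (play r y) = k.
  by apply: succn_inj; rewrite -rk (num_rounds_play yr).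
rewrite yk mulrA -[X in _ * (X + _)]mul1r.
rewrite -(history_prob_sum nN rS yk) mulr_suml -big_split /= mulr_sumr.
by apply: eq_bigr => h _; rewrite -mulrDr mulrA.
Qed.

Lemma expected_score0 N S r : supp r = finset.set0 -> expected_score D r N S = 0.
Proof.
move/eqP; rewrite supp_eq0 /expected_score => /eqP ->.
by rewrite big1 // => h _; rewrite tuple0 /= mulr0.
Qed.

Lemma num_rounds_ind (P : restriction V -> Prop) :
  (forall r, supp r = finset.set0 -> P r) ->
  (forall r, supp r != finset.set0 ->
    (forall y, y \in supp r -> P (play r y)) -> P r) ->
  forall r, P r.
Proof.
move=> P0 PS r; have [k] := ubnP (num_rounds r); elim: k r => // k IH r rk.
have [r0|r0] := eqVneq (supp r) finset.set0; first exact: P0.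
by apply: PS => // y yr; apply: IH; rewrite -ltnS -(num_rounds_play yr).
Qed.

(** Potential argument: a one-round inequality against each fixed [x] extends to mixed choices by
    averaging over [N r]. *)
Lemma expected_score_le (Phi : restriction V -> R) N S r :
  norman_strategy N -> rei_strategy S ->
  (forall r, supp r = finset.set0 -> 0 <= Phi r) ->
  (forall r x, supp r != finset.set0 ->
    \sum_y S r y * (gain R D x y + Phi (play r y)) <= Phi r) ->
  expected_score D r N S <= Phi r.
Proof.
move=> nN rS P0 PS; elim/num_rounds_ind: r => [r r0|r r0 IH].
  by rewrite expected_score0 ?P0.
rewrite expected_scoreS //.
apply: (@le_trans _ _ (\sum_x N r x * Phi r)); last first.
  by rewrite -mulr_suml (nN r).2 mul1r.
apply: ler_sum => x _; apply: ler_wpM2l; first exact: (nN r).1.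
by apply: le_trans (PS r x r0); apply: rei_sum_le => // y yr; rewrite lerD2l IH.
Qed.

Lemma expected_score_ge (Phi : restriction V -> R) N S r :
  norman_strategy N -> rei_strategy S ->
  (forall r, supp r = finset.set0 -> Phi r <= 0) ->
  (forall r, supp r != finset.set0 ->
    Phi r <= \sum_x N r x * \sum_y S r y * (gain R D x y + Phi (play r y))) ->
  Phi r <= expected_score D r N S.
Proof.
move=> nN rS P0 PS; elim/num_rounds_ind: r => [r r0|r r0 IH].
  by rewrite expected_score0 ?P0.
rewrite expected_scoreS //; apply: le_trans (PS r r0) _.
apply: ler_sum => x _; apply: ler_wpM2l; first exact: (nN r).1.
by apply: rei_sum_le => // y yr; rewrite lerD2l IH.
Qed.

(** * Bounds on scores, best responses and the value *)

Lemma gain_bound x y : -1 <= gain R D x y <= 1.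
Proof. by rewrite /gain; case: ifP => _; [|case: ifP => _]; apply/andP; split; lra. Qed.

(** Provides the bounds that make [ub_le_sup] and [ge_inf] applicable below. *)
Lemma expected_score_bound N S r : norman_strategy N -> rei_strategy S ->
  - (num_rounds r)%:R <= expected_score D r N S <= (num_rounds r)%:R.
Proof.
move=> nN rS; apply/andP; split.
  apply: (@expected_score_ge (fun r => - (num_rounds r)%:R)) => // {}r r0.
    by rewrite oppr_le0.
  rewrite -[X in X <= _](sum_distribution _ (nN r)); apply: ler_sum => x _.
  apply: ler_wpM2l; first exact: (nN r).1.
  rewrite -[X in X <= _](sum_distribution _ (rS r r0).1); apply: rei_sum_le => // y yr.
  rewrite (num_rounds_play yr) -natr1; have /andP[? ?] := gain_bound x y; lra.
apply: (@expected_score_le (fun r => (num_rounds r)%:R)) => // {}r x r0.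
rewrite -[X in _ <= X](sum_distribution _ (rS r r0).1); apply: rei_sum_le => // y yr.
rewrite (num_rounds_play yr) -natr1; have /andP[? ?] := gain_bound x y; lra.
Qed.

Definition pure (x : V) : {ffun V -> R} := [ffun v => (v == x)%:R].

Lemma sum_pure x (f : V -> R) : \sum_v pure x v * f v = f x.
Proof.
rewrite (bigD1 x) //= ffunE eqxx mul1r big1 ?addr0 // => v /negPf vx.
by rewrite ffunE vx mul0r.
Qed.

Lemma pure_distribution x : is_distribution (pure x).
Proof.
split=> [v|]; first by rewrite ffunE ler0n.
by rewrite -[RHS](sum_pure x (fun=> 1)); apply: eq_bigr => v _; rewrite mulr1.
Qed.

Lemma norman_exists (x : V) : exists N, norman_strategy N.
Proof. by exists (fun=> pure x) => r; apply: pure_distribution. Qed.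

Lemma best_response_ge N S r : norman_strategy N -> rei_strategy S ->
  expected_score D r N S <= best_response_score D r S.
Proof.
move=> nN rS; apply: ub_le_sup; last by exists N.
by exists (num_rounds r)%:R => _ [M nM <-]; case/andP: (expected_score_bound r nM rS).
Qed.

Lemma best_response_le (x : V) (e : R) S r :
  (forall N, norman_strategy N -> expected_score D r N S <= e) ->
  best_response_score D r S <= e.
Proof.
move=> Ne; apply: ge_sup; last by move=> _ [N nN <-]; apply: Ne.
by have [N nN] := norman_exists x; exists (expected_score D r N S), N.
Qed.

Lemma game_value_le (x : V) S r : rei_strategy S ->
  game_value R D r <= best_response_score D r S.
Proof.
move=> rS; apply: ge_inf; last by exists S.
exists (- (num_rounds r)%:R) => _ [M rM <-]; have [N nN] := norman_exists x.
by apply: le_trans (best_response_ge _ nN rM); case/andP: (expected_score_bound r nN rM).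
Qed.

(** * Linear payoffs and the proportional strategy *)

Definition lin (a : V -> R) r : R := \sum_v (r v)%:R * a v.

Lemma lin_play a r y : y \in supp r -> lin a (play r y) = lin a r - a y.
Proof.
rewrite inE => ry; rewrite /lin (bigD1 y) //= [in RHS](bigD1 y) //=.
rewrite ffunE eqxx natrB // mulrBl mul1r addrAC; congr (_ + _ - _).
by apply: eq_bigr => u /negPf uy; rewrite ffunE uy subn0.
Qed.

Lemma lin0 a r : supp r = finset.set0 -> lin a r = 0.
Proof.
move=> r0; rewrite /lin big1 // => v _.
by have /setP/(_ v) := r0; rewrite !inE lt0n => /negbFE/eqP ->; rewrite mul0r.
Qed.

Lemma lin_scale a r (m : nat) : lin a [ffun v => (m * r v)%N] = m%:R * lin a r.
Proof. by rewrite mulr_sumr; apply: eq_bigr => v _; rewrite ffunE natrM mulrA. Qed.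

Lemma num_rounds_lin r : (num_rounds r)%:R = lin (fun=> 1) r.
Proof. by rewrite natr_sum; apply: eq_bigr => v _; rewrite mulr1. Qed.

Definition proportional : strategy R V :=
  fun r => [ffun y => (r y)%:R / (num_rounds r)%:R].

Lemma sum_proportional a r :
  \sum_y proportional r y * a y = lin a r / (num_rounds r)%:R.
Proof. by rewrite mulr_suml; apply: eq_bigr => y _; rewrite ffunE mulrAC. Qed.

Lemma proportional_rei : rei_strategy proportional.
Proof.
move=> r r0; split; last first.
  by move=> v; rewrite inE lt0n negbK ffunE => /eqP ->; rewrite mul0r.
split=> [v|]; first by rewrite ffunE divr_ge0.
rewrite -[RHS](@divff _ (num_rounds r)%:R); last by rewrite pnatr_eq0 -supp_eq0.
rewrite {1}num_rounds_lin -sum_proportional.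
by apply: eq_bigr => v _; rewrite mulr1.
Qed.

(** * Fluctuations under proportional play *)

Definition harmonic_sum (k : nat) : R := \sum_(j < k) (j%:R)^-1.

(* Potential bounding the expected value of the sum of [(lin b r / k) ^ 2] over
   the remaining rounds, [k] being the number of rounds left, when Rei plays
   [proportional]; the junk value [0^-1 = 0] makes the first term of
   [harmonic_sum] vanish. *)
Definition deviation (b : V -> R) r : R :=
  lin b r ^+ 2 / (num_rounds r)%:R
  + (\sum_y b y ^+ 2) * harmonic_sum (num_rounds r).

Lemma deviation_ge0 b r : 0 <= deviation b r.
Proof.
apply: addr_ge0; first by rewrite divr_ge0 ?sqr_ge0.
by apply: mulr_ge0; apply: sumr_ge0 => *; rewrite ?sqr_ge0 ?invr_ge0.
Qed.

(** With [k] rounds left after the draw, the [b y ^+ 2] part of the new square costs at most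
    [c / k], exactly the term that [harmonic_sum] loses; comparing the [L ^+ 2] terms leaves the
    surplus subtracted on the right. *)
Lemma deviation_drift b r : supp r != finset.set0 ->
  \sum_y proportional r y * deviation b (play r y)
    <= deviation b r - (lin b r / (num_rounds r)%:R) ^+ 2.
Proof.
move=> r0; have := sum_proportional (fun y => b y ^+ 2) r.
have := sum_proportional b r; have := (proportional_rei r0).1.2.
set L := lin b r; case rk: (num_rounds r) => [|k].
  by rewrite supp_eq0 rk eqxx in r0.
set c := \sum_y b y ^+ 2 => s0 s1 _.
have s2 : \sum_y proportional r y * b y ^+ 2 <= c.
  rewrite -[c]mul1r -s0 mulr_suml; apply: ler_sum => y _.
  apply: ler_wpM2l; first exact: (proportional_rei r0).1.1.
  by rewrite /c (bigD1 y) //= lerDl sumr_ge0 // => *; rewrite sqr_ge0.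
rewrite (rei_sum proportional_rei r0 (g := fun y =>
  (L ^+ 2 / k%:R + c * harmonic_sum k) + (- 2 * L / k%:R) * b y
   + k%:R^-1 * b y ^+ 2)); last first.
  move=> y yr; rewrite /deviation lin_play //.
  have -> : num_rounds (play r y) = k.
    by apply: succn_inj; rewrite -rk (num_rounds_play yr).
  by rewrite -/L -/c; ring.
under eq_bigr do rewrite !mulrDr [_ * (_ * b _)]mulrCA [_ * (_ * b _ ^+ 2)]mulrCA.
rewrite !big_split /= -!mulr_suml -!mulr_sumr s0 s1 mul1r.
rewrite /deviation rk -/L -/c [harmonic_sum k.+1]/harmonic_sum big_ord_recr /=.
rewrite -/(harmonic_sum k) [c * (_ + _)]mulrDr.
have : k%:R^-1 * (\sum_y proportional r y * b y ^+ 2) <= c / k%:R.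
  by rewrite mulrC ler_wpM2r ?invr_ge0.
have : L ^+ 2 / k%:R - 2 * L / k%:R * (L / k.+1%:R) <=
       L ^+ 2 / k.+1%:R - (L / k.+1%:R) ^+ 2.
  (* In the last round [k = 0], and [0^-1 = 0] makes both sides vanish. *)
  case: k {rk s1} => [|k]; first by rewrite invr0 !mulr0 mul0r !divr1 !subrr.
  have k0 : (0 : R) < k.+1%:R by rewrite ltr0n.
  rewrite -[k.+2%:R]natr1; move: (k.+1%:R) k0 => z k0.
  rewrite -subr_ge0 (_ : _ - _ = L ^+ 2 / (z * (z + 1) ^+ 2)).
    by rewrite divr_ge0 ?sqr_ge0 // mulr_ge0 ?sqr_ge0 ?ltW.
  by field; rewrite !gt_eqF ?addr_gt0.
move: (k%:R^-1) (k.+1%:R^-1) (\sum_y proportional r y * b y ^+ 2) => u v S2; lra.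
Qed.

(** [lin (gain R D x)] is what Norman collects by always choosing [x]. Another choice pays only when
    the proportions have drifted far from those of [rho], and the squared drift is controlled by
    [deviation]. *)
Lemma best_response_proportional x (rho : restriction V) :
  (forall z, z != x -> lin (gain R D z) rho < lin (gain R D x) rho) ->
  exists C : R, forall m,
    best_response_score D [ffun v => (m * rho v)%N] proportional
      <= m%:R * lin (gain R D x) rho + C * harmonic_sum (m * num_rounds rho).
Proof.
move=> xbest.
pose K : R := (num_rounds rho)%:R.
pose mu z := (lin (gain R D x) rho - lin (gain R D z) rho) / K.
(* Centred so that [lin (b z)] vanishes on all multiples of [rho]. *)
pose b z y := gain R D x y - gain R D z y - mu z.
have lin_b z r : lin (b z) r =
    lin (gain R D x) r - lin (gain R D z) r - (num_rounds r)%:R * mu z.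
  rewrite num_rounds_lin /lin mulr_suml -!sumrB; apply: eq_bigr => v _.
  by rewrite mulr1 -!mulrBr.
have mu_ge0 z : 0 <= mu z.
  rewrite divr_ge0 // subr_ge0.
  by have [->|zx] := eqVneq z x; last exact: ltW (xbest _ zx).
(* The deviation terms are a credit for Norman's departures from [x]. For [z = x], [mu x = 0] and
   the weight is [0^-1 = 0]. *)
pose Phi r := lin (gain R D x) r + \sum_z (4 * mu z)^-1 * deviation (b z) r.
exists (\sum_z (4 * mu z)^-1 * \sum_y b z y ^+ 2) => m.
apply: (best_response_le x) => N nN; set r := [ffun _ => _].
have <- : Phi r = m%:R * lin (gain R D x) rho +
    (\sum_z (4 * mu z)^-1 * \sum_y b z y ^+ 2) * harmonic_sum (m * num_rounds rho).
  have rk : num_rounds r = (m * num_rounds rho)%N.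
    by rewrite /num_rounds big_distrr; apply: eq_bigr => v _; rewrite ffunE.
  rewrite /Phi lin_scale mulr_suml; congr (_ + _); apply: eq_bigr => z _.
  rewrite /deviation rk lin_b rk !lin_scale natrM -/K -mulrA -mulrBr -mulrBr.
  suff -> : lin (gain R D x) rho - lin (gain R D z) rho - K * mu z = 0.
    by rewrite mulr0 expr0n mul0r add0r mulrA.
  have [K0|K0] := eqVneq K 0; last by rewrite /mu mulrCA divff // mulr1 subrr.
  suff rho0 : supp rho = finset.set0 by rewrite !lin0 // K0; ring.
  by apply/eqP; rewrite supp_eq0 -(pnatr_eq0 R) -/K K0.
apply: expected_score_le => //; first exact: proportional_rei.
  move=> s s0; rewrite /Phi lin0 // add0r sumr_ge0 // => z _.
  by rewrite mulr_ge0 ?deviation_ge0 // invr_ge0 mulr_ge0.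
move=> s z s0.
set k : R := (num_rounds s)%:R.
have k0 : k != 0 by rewrite pnatr_eq0 -supp_eq0.
have k_gt0 : 0 < k by rewrite lt_def k0 ler0n.
rewrite (rei_sum proportional_rei s0 (g := fun y => gain R D z y +
   lin (gain R D x) s - gain R D x y +
   \sum_t (4 * mu t)^-1 * deviation (b t) (play s y))); last first.
  by move=> y ys; rewrite /Phi lin_play //; ring.
move elx: (lin (gain R D x) s) => lx.
under eq_bigr do rewrite mulrDr mulrBr mulrDr mulr_sumr.
rewrite big_split sumrB big_split /= [X in _ + X <= _]exchange_big /=.
rewrite -mulr_suml (proportional_rei s0).1.2 mul1r !sum_proportional -/k -elx.
have : \sum_t \sum_y proportional s y * ((4 * mu t)^-1 * deviation (b t) (play s y))
   <= \sum_t (4 * mu t)^-1 * deviation (b t) s -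
      \sum_t (4 * mu t)^-1 * (lin (b t) s / k) ^+ 2.
  rewrite -sumrB; apply: ler_sum => t _; rewrite -mulrBr.
  under eq_bigr do rewrite mulrCA.
  rewrite -mulr_sumr; apply: ler_wpM2l; first by rewrite invr_ge0 mulr_ge0.
  exact: deviation_drift.
(* The average advantage of [z] over [x] in this round is covered by the term [t = z] alone. *)
have : (lin (gain R D z) s - lin (gain R D x) s) / k <=
   \sum_t (4 * mu t)^-1 * (lin (b t) s / k) ^+ 2.
  rewrite (bigD1 z) //=.
  have t0 : 0 <= \sum_(i | i != z) (4 * mu i)^-1 * (lin (b i) s / k) ^+ 2.
    by apply: sumr_ge0 => t _; rewrite mulr_ge0 ?sqr_ge0 // invr_ge0 mulr_ge0.
  apply: le_trans (_ : _ <= (4 * mu z)^-1 * (lin (b z) s / k) ^+ 2) _; last by rewrite lerDl.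
  have [->|zx] := eqVneq z x.
    by rewrite subrr mul0r mulr_ge0 ?sqr_ge0 // invr_ge0 mulr_ge0.
  have mu0 : 0 < mu z.
    rewrite /mu divr_gt0 ?subr_gt0 ?xbest // lt_def ler0n andbT pnatr_eq0 -supp_eq0.
    by apply/eqP => rho0; have := xbest z zx; rewrite !lin0 // ltxx.
  rewrite lin_b -/k.
  set u := lin _ s; set w := lin _ s.
  (* AM-GM: [(q - mu) ^ 2 + 4 * mu * q = (q + mu) ^ 2] with [q = (w - u) / k] *)
  rewrite -subr_ge0 (_ : _ - _ = (4 * mu z)^-1 * ((w - u) / k + mu z) ^+ 2).
    by rewrite mulr_ge0 ?sqr_ge0 // invr_ge0 mulr_ge0.
  by field; rewrite k0 gt_eqF.
rewrite /Phi mulrBl; lra.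
Qed.

(** Terms of index below [M] are at most [1], the others at most [M%:R^-1]. *)
Lemma harmonic_sum_le (M k : nat) : (0 < M)%N ->
  harmonic_sum k <= M%:R + k%:R / M%:R.
Proof.
move=> M0; elim: k => [|k IH]; first by rewrite /harmonic_sum big_ord0 mul0r addr0.
have [kM|Mk] := ltnP k M.
  apply: (@le_trans _ _ M%:R); last by rewrite lerDl divr_ge0.
  apply: (@le_trans _ _ k.+1%:R); last by rewrite ler_nat.
  rewrite -[k.+1 in X in _ <= X]card_ord -sum1_card natr_sum; apply: ler_sum => j _.
  by case: (nat_of_ord j) => [|i]; rewrite ?invr0 // invf_le1 ?ler1n ?ltr0n.
rewrite /harmonic_sum big_ord_recr /= -natr1 mulrDl mul1r addrA lerD // lef_pV2 ?ler_nat //.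
  by rewrite posrE ltr0n (leq_trans M0).
by rewrite posrE ltr0n.
Qed.

(** For [m = M ^ 2] the harmonic sum is at most [M * (1 + K)], so [M * a] would stay bounded by
    [B]. *)
Lemma harmonic_sum_sublinear (a C : R) (K : nat) :
  (forall m : nat, m%:R * a <= C * harmonic_sum (m * K)) -> a <= 0.
Proof.
move=> aC; rewrite leNgt; apply/negP => a0.
pose B := `|C| * (1 + K%:R).
have B0 : 0 <= B by rewrite mulr_ge0 ?addr_ge0.
have := archi_boundP (divr_ge0 B0 (ltW a0)); move: (Num.bound _) => M.
case: M => [|M]; first by rewrite ltNge divr_ge0 // ltW.
rewrite ltr_pdivrMr // ltNge => /negP; apply.
have M0 : 0 < M.+1%:R :> R by rewrite ltr0n.
rewrite -(ler_pM2l M0) mulrA -natrM; apply: le_trans (aC _) _.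
apply: (@le_trans _ _ (`|C| * harmonic_sum (M.+1 * M.+1 * K))).
  by apply: ler_wpM2r; [apply: sumr_ge0 => *; rewrite invr_ge0|exact: ler_norm].
rewrite mulrCA; apply: ler_wpM2l => //.
apply: le_trans (harmonic_sum_le _ (ltn0Sn M)) _.
by rewrite !natrM -[_ * _ * K%:R]mulrA [_ * (_ * K%:R)]mulrC mulfK ?gt_eqF // mulrDr mulr1.
Qed.

(** * Consequences of obliviousness for the payoff matrix *)

Lemma best_response_switch S (p : {ffun V -> R}) x z r (j : nat) :
  rei_strategy S -> (forall r, supp r = [set: V]%SET -> S r = p) ->
  \sum_y p y * gain R D x y <= \sum_y p y * gain R D z y ->
  (forall v, (j <= r v)%N) ->
  lin (gain R D x) r
    + j%:R * (\sum_y p y * gain R D z y - \sum_y p y * gain R D x y)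
    <= best_response_score D r S.
Proof.
move=> rS Sp; rewrite -subr_ge0; set d := _ - _ => d0 jr.
(* The support is full during the first [j] rounds at least, and each round with full support brings
   on average [d] more than [x] would. *)
pose N : strategy R V := fun r => pure (if supp r == [set: V]%SET then z else x).
have nN : norman_strategy N by move=> s; apply: pure_distribution.
apply: le_trans (best_response_ge r nN rS).
elim/num_rounds_ind: r j jr => [r r0|r r0 IH] j jr.
  rewrite expected_score0 // lin0 // add0r.
  by have := jr x; have /setP/(_ x) := r0; rewrite !inE lt0n => /negbFE/eqP ->;
    rewrite leqn0 => /eqP ->; rewrite mul0r.
rewrite expected_scoreS // sum_pure; case: eqP => [rT|/eqP rT].
  have p1 : \sum_y p y = 1 by rewrite -(Sp r rT) (rS r r0).1.2.
  apply: le_trans (rei_sum_le (f := fun y => gain R D z y +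
    (lin (gain R D x) r + j.-1%:R * d) - gain R D x y) rS r0 _); last first.
    move=> y yr; rewrite -addrA lerD2l.
    apply: le_trans (IH y yr j.-1 _); first by rewrite lin_play //; lra.
    move=> v; rewrite ffunE; have := jr v; case: (v == y) => jv; last first.
      by rewrite subn0 (leq_trans (leq_pred _)).
    by rewrite subn1 -!subn1 leq_sub2r.
  under eq_bigr do rewrite (Sp r rT) mulrBr mulrDr.
  rewrite sumrB big_split /= -mulr_suml p1 mul1r addrAC -/d addrC -addrA lerD2l.
  (* For [j = 0] the bonus [d] of this round is dropped, by [0 <= d]. *)
  case: j {jr IH} => [|j] /=; first by rewrite mul0r add0r.
  by rewrite -natr1 mulrDl mul1r.
have {jr} -> : j = 0%N.
  have [v vr] : exists v, v \notin supp r.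
    apply/existsP; rewrite -negb_forall; apply: contra rT => /forallP rT.
    by apply/eqP/setP => v; rewrite rT inE.
  by move: vr (jr v); rewrite inE -leqNgt leqn0 => /eqP ->; rewrite leqn0 => /eqP.
rewrite mul0r addr0 -[X in X <= _](sum_distribution _ (rS r r0).1).
apply: rei_sum_le => // y yr; rewrite -lerBlDl.
by apply: le_trans (IH y yr 0%N _) => //; rewrite lin_play // mul0r addr0.
Qed.

(** At [m * rho], optimality bounds [m * d] by a multiple of a harmonic sum, so [d > 0] is
    impossible for large [m]. *)
Lemma oblivious_equalizes S (p : {ffun V -> R}) x :
  rei_strategy S -> optimal D S ->
  (forall r, supp r = [set: V]%SET -> S r = p) -> is_distribution p ->
  (forall z, z != x -> ~~ (out_nbr D x \subset out_nbr D z)) ->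
  forall z, \sum_y p y * gain R D z y <= \sum_y p y * gain R D x y.
Proof.
move=> rS oS Sp pd xundom z; rewrite leNgt; apply/negP => zx.
have : 0 < \sum_y p y * gain R D z y - \sum_y p y * gain R D x y by rewrite subr_gt0.
set d := _ - _ => d0.
have [K KV] : exists K : nat, (2 * #|V| < K)%N by exists (2 * #|V|).+1.
(* Each [t != x] misses some out-neighbour of [x], which is worth [K], while every vertex gives back
   at most [2]. The successor keeps all entries positive. *)
pose rho : restriction V := [ffun v => (K * (v \in out_nbr D x)).+1].
have xbest t : t != x -> lin (gain R D t) rho < lin (gain R D x) rho.
  move=> tx; have /fintype.subsetPn[y xy ty] := xundom t tx.
  rewrite -subr_gt0 /lin -sumrB.
  have lb v : K%:R * (v == y)%:R - 2 <= (rho v)%:R * gain R D x v - (rho v)%:R * gain R D t v.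
    rewrite ffunE -[(_ * _).+1%:R]natr1 natrM.
    have /andP[g1 g2] := gain_bound t v; have /andP[g3 g4] := gain_bound x v.
    have K0 : 0 <= K%:R :> R by [].
    have [->|vy] := eqVneq v y.
      have g5 : gain R D t y <= 0.
        by rewrite /gain (negPf ty); case: ifP => _ //; rewrite lerN10.
      have g6 : gain R D x y = 1 by rewrite /gain xy.
      by rewrite xy g6 /=; nra.
    have [xv|xv] := boolP (v \in out_nbr D x); rewrite /= ?mulr0; last by lra.
    have -> : gain R D x v = 1 by rewrite /gain xv.
    by nra.
  apply: lt_le_trans (ler_sum _ (fun v _ => lb v)).
  rewrite sumrB -mulr_sumr (bigD1 y) //= eqxx big1 => [|v /negPf -> //].
  by rewrite addr0 mulr1 sumr_const -[2 *+ _]mulr_natr -natrM subr_gt0 ltr_nat.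
have [C HC] := best_response_proportional xbest.
suff : d <= 0 by rewrite leNgt d0.
apply: (@harmonic_sum_sublinear d C (num_rounds rho)) => m.
have := best_response_switch (r := [ffun v => (m * rho v)%N]) (j := m) rS Sp (ltW zx).
rewrite -/d lin_scale => /(_ _)/le_trans H.
rewrite -(lerD2l (m%:R * lin (gain R D x) rho)); apply: H.
  by move=> v; rewrite !ffunE leq_pmulr.
by rewrite oS; apply: le_trans (HC m); apply: game_value_le proportional_rei.
Qed.

Lemma gain_skew x y : is_tournament D -> gain R D x y = - gain R D y x.
Proof.
move=> /andP[/forallP irr /forallP tour]; rewrite /gain !inE.
have [->|xy] := eqVneq x y; first by rewrite (negPf (irr y)) oppr0.
have /forallP/(_ y) := tour x; rewrite xy /=.
by case: ((x, y) \in D); case: ((y, x) \in D); rewrite ?opprK.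
Qed.

Lemma oblivious_kernel (v0 : V) : is_tournament D -> oblivious R D ->
  (forall x z, z != x -> ~~ (out_nbr D x \subset out_nbr D z)) ->
  exists p : {ffun V -> R},
    is_distribution p /\ forall x, \sum_y p y * gain R D x y = 0.
Proof.
move=> tour [S [rS oS obl]] undom.
pose one : restriction V := [ffun=> 1%N].
have oneT : supp one = [set: V]%SET by apply/setP => v; rewrite !inE ffunE.
have one0 : supp one != finset.set0.
  by apply/eqP => /setP/(_ v0); rewrite oneT !inE.
have Sp r : supp r = [set: V]%SET -> S r = S one by move=> rT; apply: obl; rewrite rT.
exists (S one); split; first exact: (rS _ one0).1.
have [p0 p1] := (rS _ one0).1.
set p := S one in p0 p1 Sp *; pose M x := \sum_y p y * gain R D x y.
have Mc x : M x = M v0.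
  apply/eqP; rewrite eq_le.
  by apply/andP; split; apply: (oblivious_equalizes rS oS Sp) => // z zx; apply: undom.
(* The common value is the payoff of [p] against itself, equal to its own opposite by
   skew-symmetry. *)
have M0 : M v0 = 0.
  have : \sum_x p x * M x = - \sum_x p x * M x.
    rewrite -sumrN {1}/M; under eq_bigr do rewrite mulr_sumr.
    rewrite exchange_big; apply: eq_bigr => y _ /=; rewrite -mulrN -sumrN mulr_sumr.
    by apply: eq_bigr => x _; rewrite (gain_skew x) // mulrCA mulrN.
  under eq_bigr do rewrite Mc.
  by rewrite -mulr_suml p1 mul1r; lra.
by move=> x; exact: etrans (Mc x) M0.
Qed.

End Game.

(** * Reversal of arcs *)

Section Flip.
Variable V : finType.
Implicit Types (D : digraph V) (h : rel V).

(** Symmetrising [h] toggles [(u, v)] and [(v, u)] together. *)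
Definition flip h D : digraph V :=
  [set e | (e \in D) (+) (h e.1 e.2 || h e.2 e.1)]%SET.

Lemma in_flip h D u v : ((u, v) \in flip h D) = ((u, v) \in D) (+) (h u v || h v u).
Proof. by rewrite inE. Qed.

Lemma flipK h : involutive (flip h).
Proof. by move=> D; apply/setP => -[u v]; rewrite !in_flip -addbA addbb addbF. Qed.

Lemma flip_tournament h D : irreflexive h -> is_tournament D -> is_tournament (flip h D).
Proof.
move=> hirr /andP[/forallP irr /forallP tour]; apply/andP; split.
  by apply/forallP => u; rewrite in_flip hirr /= addbF irr.
apply/forallP => u; apply/forallP => v; apply/implyP => uv; rewrite !in_flip.
have /forallP/(_ v)/implyP/(_ uv) := tour u.
by rewrite [h v u || _]orbC addbACA addbb addbF.
Qed.

End Flip.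

Lemma tournament_gain (R : realType) (V : finType) (D : digraph V) x y :
  is_tournament D -> gain R D x y = (x != y)%:R * (-1) ^+ ((x, y) \notin D).
Proof.
move=> /andP[/forallP irr /forallP tour]; rewrite /gain !inE.
have [->|xy] := eqVneq x y; first by rewrite (negPf (irr y)) mul0r.
have /forallP/(_ y) := tour x; rewrite xy mul1r /=.
by case: ((x, y) \in D); case: ((y, x) \in D).
Qed.

(** * Counting tournaments with nested out-neighbourhoods *)

Section Dominated.
Variable V : finType.
Implicit Types D : digraph V.

Definition dominated (x z : V) : {set digraph V} :=
  [set D | is_tournament D && (out_nbr D x \subset out_nbr D z)]%SET.

(* Resampling all arcs between [{x, z}] and the other vertices: the flips [g]
   take 4 values per vertex, the patterns of a dominated pair only 3. *)
Lemma card_dominated x z : x != z ->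
  (#|dominated x z| * 4 ^ (#|V| - 2)
     <= #|[set D : digraph V | is_tournament D]%SET| * 3 ^ (#|V| - 2))%N.
Proof.
move=> xz; pose I := (~: [set x; z])%SET.
have inI y : (y \in I) = (y != x) && (y != z) by rewrite !inE negb_or.
have cI : #|I| = (#|V| - 2)%N.
  by rewrite cardsCs finset.setCK cards2 xz.
pose B4 := [set g : {ffun V -> bool * bool} |
  g \in pffun_on (false, false) (mem I) predT]%SET.
pose B3 := [set g : {ffun V -> bool * bool} |
  g \in pffun_on (false, false) (mem I) [pred b | b.1 ==> b.2]]%SET.
have -> : (4 ^ (#|V| - 2) = #|B4|)%N.
  by rewrite cardsE card_pffun_on cI card_prod card_bool.
have -> : (3 ^ (#|V| - 2) = #|B3|)%N.
  rewrite cardsE card_pffun_on cI; congr (_ ^ _)%N.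
  by rewrite cardE /enum_mem unlock /= /prod_enum /= enumT unlock.
pose h (g : {ffun V -> bool * bool}) : rel V :=
  fun u v => (u == x) && (g v).1 || (u == z) && (g v).2.
pose pattern D : {ffun V -> bool * bool} := [ffun y =>
  if y \in I then ((x, y) \in D, (z, y) \in D) else (false, false)].
have B4P g : g \in B4 -> forall y, y \notin I -> g y = (false, false).
  rewrite inE => /pffun_onP[/fintype.subsetP gI _] y yI.
  by apply/eqP; apply: contraNT yI => gy; apply: gI.
rewrite -!cardsX.
pose f p := (flip (h p.2) p.1, pattern p.1).
(* On [I], [g] is the exclusive or of the recorded pattern and the arcs of the flipped tournament;
   flipping back by [g] then recovers [D]. *)
have finj : {in finset.setX (dominated x z) B4 &, injective f}.
  move=> [D g] [D' g'] /setXP[/= _ gB] /setXP[/= _ gB'] [eD eP].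
  have eg : g = g'.
    apply/ffunP => y; have [yI|yI] := boolP (y \in I); last by rewrite !B4P.
    have := congr1 (fun F : {ffun V -> bool * bool} => F y) eP; rewrite !ffunE yI => -[ex ez].
    have [yx yz] : y != x /\ y != z by move: yI; rewrite inI => /andP[].
    have /setP eDP := eD; have := eDP (x, y); have := eDP (z, y); rewrite !in_flip ex ez.
    rewrite /h (negPf yx) (negPf yz) !eqxx (negPf xz) (eq_sym z) (negPf xz) /= !orbF.
    move=> /addbI e2 /addbI e1.
    by rewrite (surjective_pairing (g y)) e1 e2 -surjective_pairing.
  by rewrite -eg; congr (_, _); apply: (can_inj (flipK (h g))); rewrite eD eg.
rewrite -(card_in_imset finj); apply: subset_leq_card.
apply/fintype.subsetP => _ /imsetP[[D g] /setXP[/= Dd gB] ->].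
move: Dd; rewrite inE => /andP[tour /fintype.subsetP xsub].
apply/setXP; split; rewrite /= inE.
  apply: flip_tournament tour => u; rewrite /h.
  have [->|] := eqVneq u x; first by rewrite (B4P g gB) ?inI ?eqxx ?andbF.
  by have [->|] := eqVneq u z; first by rewrite (B4P g gB) ?inI ?eqxx ?andbF.
apply/pffun_onP; split.
  by apply/fintype.subsetP => y; rewrite inE ffunE; case: ifP; rewrite ?eqxx.
move=> b /mapP[y]; rewrite mem_enum => yI ->; rewrite ffunE yI inE /=; apply/implyP => xy.
by have := xsub y; rewrite !inE => ->.
Qed.

End Dominated.

(** * Kernel of the payoff matrix and switching classes *)

Section Kernel.
Variables (R : realType) (n : nat).
Implicit Types (D : digraph 'I_n) (q : 'I_n -> R).

Definition in_kernel D q := forall x, \sum_y q y * gain R D x y = 0.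

(* Adding [n] times the all-ones vector to row [v] of the (transposed) payoff
   matrix does not change its action on vectors vanishing at [v], and makes the
   matrix invertible modulo 2, where the payoff matrix is [J - I]. *)
Lemma kernel_coord_eq0 D q v : is_tournament D -> in_kernel D q ->
  q v = 0 -> forall y, q y = 0.
Proof.
move=> tour qker qv.
(* Modulo 2 the added row is zero for even [n], when [J - I] is already invertible, and all ones for
   odd [n]. *)
pose C : 'M[int]_n := \matrix_(i, j)
  ((j != i)%:R * (-1) ^+ ((j, i) \notin D) + n%:R * (i == v)%:R).
have detC : \det C != 0.
  apply/eqP => C0; have : \det (map_mx (intr : int -> 'F_2) C) == 0.
    by rewrite det_map_mx C0.
  apply/negP/det0P => -[w w0 wC]; case/eqP: w0.
  have F2 (a : 'F_2) : a + a = 0 by rewrite -mulr2n mulr2n -mulr2n mulrn_pchar // pchar_Fp.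
  have N1 : -1 = 1 :> 'F_2 by apply/eqP; rewrite eq_sym -subr_eq0 opprK F2.
  have wj j : w 0 j = (\sum_i w 0 i) + n%:R * w 0 v.
    have := congr1 (fun M : 'rV_n => M 0 j) wC; rewrite !mxE.
    under eq_bigr => i _ do rewrite !mxE rmorphD !rmorphM rmorphXn rmorphN1 !rmorph_nat N1
      expr1n mulr1 mulrDr.
    rewrite big_split /= (bigD1 j) //= eqxx mulr0 add0r.
    rewrite (bigD1 v (P := xpredT)) //= eqxx mulr1 [X in _ + (_ + X)]big1 ?addr0; last first.
      by move=> i /negPf ->; rewrite !mulr0.
    under eq_bigr => i ij do rewrite eq_sym ij mulr1.
    move=> e; rewrite (bigD1 j) //= -addrA [n%:R * _]mulrC e addr0 //.
  (* By [wj] all coordinates of [w] agree, so their sum is [n%:R * w 0 v], and each coordinate is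
     twice that. *)
  apply/rowP => j; rewrite mxE wj -(wj v) wj.
  have : \sum_i w 0 i = n%:R * w 0 v.
    under eq_bigr => i _ do rewrite wj -(wj v).
    by rewrite sumr_const card_ord mulr_natl.
  by move=> ->; rewrite F2.
have detCR : \det (map_mx (intr : int -> R) C) != 0 by rewrite det_map_mx intr_eq0.
move=> y; pose w : 'rV[R]_n := \row_i q i.
have [w0|w0] := eqVneq w 0; first by have := congr1 (fun M : 'rV_n => M 0 y) w0; rewrite !mxE.
case/negP: detCR; apply/det0P; exists w => //; apply/rowP => j; rewrite !mxE -[RHS](qker j).
apply: eq_bigr => i _; rewrite !mxE (tournament_gain _ _ _ tour).
rewrite rmorphD !rmorphM rmorphXn rmorphN1 !rmorph_nat.
by have [->|_] := eqVneq i v; [rewrite qv !mul0r|rewrite mulr0 addr0].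
Qed.

(** The combination [q' v * q - q v * q'] is a kernel vector vanishing at [v]. *)
Lemma kernel_proportional D q q' v : is_tournament D ->
  in_kernel D q -> in_kernel D q' -> forall y, q' v * q y = q v * q' y.
Proof.
move=> tour qk qk' y; apply/eqP; rewrite -subr_eq0; apply/eqP.
apply: (kernel_coord_eq0 (v := v) (q := fun y => q' v * q y - q v * q' y) tour).
  move=> x; under eq_bigr do rewrite mulrBl -!mulrA.
  by rewrite sumrB -!mulr_sumr qk qk' !mulr0 subrr.
by rewrite mulrC subrr.
Qed.

Definition balanced D : Prop :=
  exists p : {ffun 'I_n -> R}, is_distribution p /\ in_kernel D p.

Lemma balanced_pos D (p : {ffun 'I_n -> R}) :
  is_tournament D -> is_distribution p -> in_kernel D p -> forall v, 0 < p v.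
Proof.
move=> tour [p0 p1] pk v; rewrite lt_def p0 andbT; apply/eqP => pv.
have := p1; rewrite big1 => [/eqP|y _]; first by rewrite eq_sym oner_eq0.
exact: (kernel_coord_eq0 tour pk pv).
Qed.

Definition cut (S : {set 'I_n}) : rel 'I_n := fun u v => (u \in S) (+) (v \in S).

Lemma cut_irr S : irreflexive (cut S).
Proof. by move=> u; rewrite /cut addbb. Qed.

Lemma in_switch S D u v :
  ((u, v) \in flip (cut S) D) = ((u, v) \in D) (+) ((u \in S) (+) (v \in S)).
Proof. by rewrite in_flip /cut [(v \in S) (+) _]addbC orbb. Qed.

(** Switching conjugates the payoff matrix by the diagonal matrix of the signs
    [(-1) ^+ (y \in S)]. *)
Lemma kernel_switch S D q : is_tournament D -> in_kernel D q ->
  in_kernel (flip (cut S) D) (fun y => (-1) ^+ (y \in S) * q y).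
Proof.
move=> tour qk x; have tour' := flip_tournament (cut_irr S) tour.
transitivity ((-1) ^+ (x \in S) * \sum_y q y * gain R D x y); last by rewrite qk mulr0.
rewrite mulr_sumr; apply: eq_bigr => y _.
rewrite !tournament_gain // in_switch.
case: ((x, y) \in D); case: (x \in S); case: (y \in S); rewrite /= ?expr0 ?expr1; ring.
Qed.

(* A switching class has exactly one tournament per sign vector (up to global
   sign), and the kernel is at most one-dimensional. *)
Lemma card_balanced : (0 < n)%N ->
  (#|[set D in tournaments n | `[< balanced D >]]%SET| * 2 ^ n.-1
     <= #|tournaments n|)%N.
Proof.
(* A set and its complement define the same cut; only the one avoiding [v0] is kept. *)
move=> n0; pose v0 := Ordinal n0; pose P := powerset [set~ v0].
have -> : (2 ^ n.-1 = #|P|)%N.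
  by rewrite card_powerset cardsC1 card_ord.
set B := [set D in _ | _]%SET; rewrite -cardsX.
pose f (p : digraph 'I_n * {set 'I_n}) := flip (cut p.2) p.1.
have finj : {in finset.setX B P &, injective f}.
  move=> [D S] [D' S'] /setXP[/= DB SP] /setXP[/= DB' SP'] e.
  suff eS : S = S'.
    by rewrite -eS; congr (_, _); apply: (can_inj (flipK (cut S))); rewrite [LHS]e eS.
  move: DB DB'; rewrite !inE => /andP[tD /asboolP[p [pd pk]]] /andP[tD' /asboolP[p' [pd' pk']]].
  have k := kernel_switch S tD pk; have k' := kernel_switch S' tD' pk'.
  have v0S X : X \in P -> (v0 \in X) = false.
    by rewrite powersetE => /fintype.subsetP XP; apply/negP => /XP; rewrite !inE eqxx.
  rewrite [flip _ _](e : _ = flip (cut S') D') in k.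
  apply/setP => y.
  (* Both signed vectors are positive at [v0], so proportionality makes their signs agree at [y]. *)
  have := kernel_proportional v0 (flip_tournament (cut_irr S') tD') k k' y.
  rewrite /= !v0S // !expr0 !mul1r.
  have a1 := balanced_pos tD pd pk; have a2 := balanced_pos tD' pd' pk'.
  have b1 := mulr_gt0 (a2 v0) (a1 y); have b2 := mulr_gt0 (a1 v0) (a2 y).
  by case: (y \in S); case: (y \in S'); rewrite ?expr0 ?expr1 => // H; move: b1 b2 H; clear; lra.
rewrite -(card_in_imset finj); apply: subset_leq_card.
apply/fintype.subsetP => _ /imsetP[[D S] /setXP[/= DB _] ->].
move: DB; rewrite !inE => /andP[tD _].
exact: flip_tournament (cut_irr S) tD.
Qed.

End Kernel.

(** * Union bound and exponential decay *)

Lemma oblivious_balanced_or_dominated (R : realType) (n : nat) (D : digraph 'I_n) :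
  (0 < n)%N -> is_tournament D -> oblivious R D ->
  balanced R D \/ exists x z, x != z /\ D \in dominated x z.
Proof.
move=> n0 tour obl.
have [[x [z xz]]|no] := pselect (exists x z, x != z /\ D \in dominated x z).
  by right; exists x, z.
left; apply: (oblivious_kernel (Ordinal n0)) => // x z zx; apply/negP => sub.
by apply: no; exists x, z; rewrite eq_sym inE tour.
Qed.

(** The case [t = 0] holds through [0^-1 = 0], so the number of tournaments need not be shown
    positive. *)
Lemma ratio_le (R : realFieldType) (a t b c : nat) : (0 < b)%N ->
  (a * b <= t * c)%N -> (a%:R / t%:R <= c%:R / b%:R :> R).
Proof.
move=> b0; case: t => [|t] ab; first by rewrite invr0 mulr0 divr_ge0.
rewrite ler_pdivrMr ?ltr0n // mulrAC ler_pdivlMr ?ltr0n //.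
by rewrite -!natrM ler_nat [(c * _)%N]mulnC.
Qed.

Lemma tournament_prob_oblivious (R : realType) (n : nat) :
  tournament_prob R (fun D : digraph 'I_n.+2 => oblivious R D)
    <= (2^-1) ^+ n.+1 + (n.+2%:R) ^+ 2 * (3 / 4) ^+ n.
Proof.
rewrite /tournament_prob; set O := [set D in _ | _]%SET; set t := #|tournaments _|.
pose B := [set D in tournaments n.+2 | `[< balanced R D >]]%SET.
have sub : O \subset B :|: \bigcup_(p | p.1 != p.2) dominated p.1 p.2.
  apply/fintype.subsetP => D; rewrite !inE => /andP[tour /asboolP obl].
  have [bal|[x [z [xz Dxz]]]] := oblivious_balanced_or_dominated (ltn0Sn _) tour obl.
    by rewrite tour /=; apply/orP; left; apply/asboolP.
  by apply/orP; right; apply/bigcupP; exists (x, z).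
have card : (#|O| <= #|B| + \sum_(p : 'I_n.+2 * 'I_n.+2 | p.1 != p.2) #|dominated p.1 p.2|)%N.
  apply: leq_trans (subset_leq_card sub) _; apply: leq_trans (leq_card_setU _ _) _.
  rewrite leq_add2l; elim/big_ind2: _ => [|A a C c Aa Cc|//]; first by rewrite cards0.
  exact: leq_trans (leq_card_setU _ _) (leq_add Aa Cc).
apply: (@le_trans _ _ (#|B|%:R / t%:R +
    \sum_(p : 'I_n.+2 * 'I_n.+2 | p.1 != p.2) #|dominated p.1 p.2|%:R / t%:R)).
  by rewrite -mulr_suml -mulrDl -natr_sum -natrD ler_wpM2r ?invr_ge0 ?ler_nat.
apply: lerD.
  have := card_balanced R (ltn0Sn n.+1); rewrite -[X in (_ <= X)%N]muln1.
  move=> /(ratio_le R (expn_gt0 2 _))/le_trans; apply.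
  by rewrite natrX div1r exprVn.
apply: (@le_trans _ _ (\sum_(p : 'I_n.+2 * 'I_n.+2 | p.1 != p.2) (3 / 4) ^+ n)).
  apply: ler_sum => p /card_dominated; rewrite card_ord subn2 /=.
  move=> /(ratio_le R (expn_gt0 4 _))/le_trans; apply.
  by rewrite !natrX expr_div_n.
rewrite sumr_const -[_ *+ _]mulr_natl ler_wpM2r ?exprn_ge0 ?divr_ge0 //.
by rewrite -natrX ler_nat (leq_trans (max_card _)) // card_prod card_ord.
Qed.

Theorem theorem4p3 (R : realType) :
  exists c : R, 0 < c /\
    exists n0 : nat, forall n : nat, (n0 <= n)%N ->
      tournament_prob R (fun D : digraph 'I_n => oblivious R D)
        <= expR (- (c * n%:R)).
Proof.
(* Half of the decay rate [ln (4 / 3)]; the other half is spent on the polynomial factor. *)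
pose c : R := ln (4 / 3) / 2.
have c0 : 0 < c by apply: divr_gt0 => //; apply: ln_gt0; lra.
have ec n : (3 / 4) ^+ n = expR (- (2 * c * n%:R)) :> R.
  rewrite -mulNr expRM_natr; congr (_ ^+ n).
  by rewrite /c [2 * _]mulrC divfK ?pnatr_eq0 // expRN lnK ?posrE ?divr_gt0 // invf_div.
(* [(c n)^3 / 6 <= e^(c n)] absorbs the polynomial factor. *)
pose A : R := 24 / c ^+ 3.
exists c; split=> //; exists (Num.bound A).+2 => -[|[|n]] // nA.
apply: le_trans (tournament_prob_oblivious R n) _.
have {}nA : A <= n.+2%:R.
  have A0 : 0 <= A by rewrite divr_ge0 // exprn_ge0 // ltW.
  by apply: le_trans (ltW (archi_boundP A0)) _; rewrite ler_nat (leq_trans _ nA) // -addn2 leq_addr.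
set N : R := n.+2%:R in nA *.
have N1 : 1 <= N by rewrite ler1n.
have h1 : (2^-1) ^+ n.+1 <= 2 * (3 / 4) ^+ n.+2 :> R.
  have -> : 2^-1 ^+ n.+1 = 2 * (2^-1) ^+ n.+2 :> R.
    by rewrite [in RHS]exprS mulrA divff ?pnatr_eq0 // mul1r.
  by rewrite ler_wpM2l // lerXn2r ?nnegrE //; lra.
have h2 : N ^+ 2 * (3 / 4) ^+ n = 16 / 9 * N ^+ 2 * (3 / 4) ^+ n.+2.
  by rewrite !exprS; field.
(* Here [2 + 16 / 9 <= 4], and [1 <= N ^+ 2]. *)
apply: (@le_trans _ _ (4 * N ^+ 2 * (3 / 4) ^+ n.+2)).
  rewrite h2; have : 0 <= (3 / 4) ^+ n.+2 :> R by rewrite exprn_ge0 // divr_ge0.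
  have := exprn_ege1 2 N1; move: ((3 / 4) ^+ n.+2) ((2^-1) ^+ n.+1) (N ^+ 2) h1.
  by move=> q a N2 h1 N21 q0; nra.
rewrite ec -/N (_ : - (2 * c * N) = - (c * N) + - (c * N)); last by ring.
rewrite expRD mulrA -[X in _ <= X]mul1r ler_wpM2r ?expR_ge0 //.
rewrite [expR (- _)]expRN ler_pdivrMr ?expR_gt0 // mul1r.
have cN : 0 <= c * N by rewrite mulr_ge0 ?ltW // (lt_le_trans _ N1).
apply: le_trans (expR_ge1Dxn 2 cN).
rewrite -[_`!%:R]/(6%:R); apply: (@le_trans _ _ ((c * N) ^+ 3 / 6)); last by rewrite lerDr.
rewrite exprMn [N ^+ 3]exprS.
(* [24] is [4 * 6]: the coefficient [4] times the factorial of [3]. *)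
have : 24 <= c ^+ 3 * N.
  by move: nA; rewrite ler_pdivrMr ?exprn_gt0 // mulrC.
have : 0 <= N ^+ 2 by rewrite sqr_ge0.
move: (N ^+ 2) (c ^+ 3) => n2 c3 n20 h; nra.
Qed.
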